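(* Let $(\Lambda,\phi,\alpha)$ be a smooth solution on $[0,\infty)\times\mathbb{R}$ of $$\begin{cases}\partial_t(\alpha\,\partial_t\Lambda)-\partial_x(\alpha\,\partial_x\Lambda)=2\alpha\sinh(2\Lambda)\big((\partial_t\phi)^2-(\partial_x\phi)^2\big),\\ \partial_t(\alpha\sinh^2\Lambda\,\partial_t\phi)-\partial_x(\alpha\sinh^2\Lambda\,\partial_x\phi)=0,\\ \partial_t^2\alpha-\partial_x^2\alpha=0,\end{cases}$$ such that for all $(t,x)\in[0,\infty)\times\mathbb{R}$, $$\alpha(t,x)>0,\qquad\partial_t\alpha(t,x)>0,\qquad(\partial_x\alpha)^2(t,x)-(\partial_t\alpha)^2(t,x)<0.$$ Assume in addition that: (a) $\sup_{t\ge0}E[\Lambda,\phi;\alpha](t)<+\infty$, where $$E[\Lambda,\phi;\alpha](t)=-\int_{\mathbb{R}}\kappa\,\big(\partial_t\alpha\,h_1-2\,\partial_x\alpha\,h_2\big)(t,x)\,dx;$$ (b) for some $c_0>0$ one has $\alpha(t,x)>c_0$ for all $(t,x)$, and $\partial_t\alpha$ is in the Schwartz class uniformly in time, in the sense that $\partial_t\alpha(t,x)=F(t+x)+H(t-x)$ with $F,H\in\mathcal{S}(\mathbb{R})$. Then, for any $v\in\mathbb{R}$ with $|v|<1$, with $\omega(t)=t(\log t)^{-2}$, and for every constant $C>0$, $$\lim_{t\to+\infty}\int_{|x-vt|\le C\omega(t)}\Big[(\partial_t\Lambda)^2+(\partial_x\Lambda)^2+\sinh^2(\Lambda)\big((\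partial_t\phi)^2+(\partial_x\phi)^2\big)\Big](t,x)\,dx=0.$$
   Context: Here $$\kappa=\frac{\alpha}{(\partial_x\alpha)^2-(\partial_t\alpha)^2},\quad h_1=(\partial_t\Lambda)^2+(\partial_x\Lambda)^2+4\sinh^2(\Lambda)\big((\partial_x\phi)^2+(\partial_t\phi)^2\big),\quad h_2=\partial_t\Lambda\,\partial_x\Lambda+4\sinh^2(\Lambda)\,\partial_t\phi\,\partial_x\phi.$$ The integrand of $E$ is nonnegative under the stated conditions on $\alpha$, so $E\in[0,+\infty]$. $\mathcal{S}(\mathbb{R})$ is the Schwartz class. *)

(* Defs.v *)
From HB Require Import structures.
From mathcomp Require Export all_boot all_order all_algebra.
From mathcomp Require Export all_classical all_reals all_analysis.

Set Implicit Arguments.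
Unset Strict Implicit.
Unset Printing Implicit Defensive.

Export Order.TTheory GRing.Theory Num.Theory.
Export numFieldNormedType.Exports.

Local Open Scope classical_set_scope.
Local Open Scope ring_scope.

(* Fields on [0, +oo[ x R are curried functions u : R -> R -> R, read u t x.
   The values u t x with t < 0 are junk: nothing below depends on them. *)
Section HalfPlane.
Context {R : realType}.
Implicit Types u : R -> R -> R.

Definition halfplane : set (R * R) := [set p | 0 <= p.1].

(* Increments h are restricted to t + h >= 0, so that this is the ordinary
   two-sided derivative for t > 0 and the right derivative at t = 0. *)
Definition dt_quotient u (t x : R) : R -> R :=
  fun h => h^-1 * (u (t + h) x - u t x).
Definition dt_filter (t : R) : set_system R :=
  within [set h : R | 0 <= t + h] (0 : R)^'.
Definition derivable_t u (t x : R) : Prop :=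
  cvg (dt_quotient u t x h @[h --> dt_filter t]).
Definition dt u (t x : R) : R :=
  lim (dt_quotient u t x h @[h --> dt_filter t]).

Definition dx u (t x : R) : R := derive1 (u t) x.

(* Class C^k up to the boundary t = 0. *)
Fixpoint Ck (k : nat) u : Prop :=
  {within halfplane, continuous (fun p : R * R => u p.1 p.2)} /\
  match k with
  | 0%N => True
  | k'.+1 =>
      [/\ forall t x : R, 0 <= t -> derivable_t u t x /\ derivable (u t) x 1,
          Ck k' (dt u) & Ck k' (dx u)]
  end.

Definition smooth u : Prop := forall k : nat, Ck k u.

End HalfPlane.

Section Model.
Context {R : realType}.

Definition sinh (y : R) : R := (expR y - expR (- y)) / 2.

Definition schwartz (F : R -> R) : Prop :=
  (forall (n : nat) (y : R), derivable (derive1n n F) y 1) /\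
  (forall m n : nat, exists M : R,
     forall y : R, `|y| ^+ m * `|derive1n n F y| <= M).

Implicit Types Lambda phi alpha : R -> R -> R.

Definition solution Lambda phi alpha : Prop :=
  forall t x : R, 0 <= t ->
  [/\ dt (fun s y => alpha s y * dt Lambda s y) t x
        - dx (fun s y => alpha s y * dx Lambda s y) t x
      = 2 * alpha t x * sinh (2 * Lambda t x)
          * ((dt phi t x) ^+ 2 - (dx phi t x) ^+ 2),
      dt (fun s y => alpha s y * (sinh (Lambda s y)) ^+ 2 * dt phi s y) t x
        - dx (fun s y => alpha s y * (sinh (Lambda s y)) ^+ 2 * dx phi s y) t x
      = 0
    & dt (dt alpha) t x - dx (dx alpha) t x = 0].

Definition kappa alpha (t x : R) : R :=
  alpha t x / ((dx alpha t x) ^+ 2 - (dt alpha t x) ^+ 2).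

Definition h1 Lambda phi (t x : R) : R :=
  (dt Lambda t x) ^+ 2 + (dx Lambda t x) ^+ 2
  + 4 * (sinh (Lambda t x)) ^+ 2 * ((dx phi t x) ^+ 2 + (dt phi t x) ^+ 2).

Definition h2 Lambda phi (t x : R) : R :=
  dt Lambda t x * dx Lambda t x
  + 4 * (sinh (Lambda t x)) ^+ 2 * dt phi t x * dx phi t x.

Definition energy Lambda phi alpha (t : R) : \bar R :=
  (- \int[@lebesgue_measure R]_x
       (kappa alpha t x * (dt alpha t x * h1 Lambda phi t x
                           - 2 * dx alpha t x * h2 Lambda phi t x))%:E)%E.

Definition omega (t : R) : R := t * (ln t) ^- 2.

End Model.

(* Main.v *)
Require Import Defs.
From mathcomp Require Import measurable_realfun ring lra.

Set Implicit Arguments.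
Unset Strict Implicit.
Unset Printing Implicit Defensive.

(** The energy is weighted by the inverse of [dt alpha], and this weight alone
    forces the decay.

    With [a := dt alpha] and [b := dx alpha], the energy density is
    [alpha * (a h1 - 2 b h2) / (a^2 - b^2)]. In the null frame,
    [h1 + 2 h2] and [h1 - 2 h2] are the squared lengths of the derivatives of the
    fields along the two null directions, hence both are nonnegative, and
    [[
      (a^2 + b^2) h1 - 4 a b h2
        = ((a - b)^2 (h1 + 2 h2) + (a + b)^2 (h1 - 2 h2)) / 2 >= 0.
    ]]
    This is [alpha * h1 <= 2 a * density] after clearing the denominator
    ([energy_density_lower_bound]). So, since [alpha > c0], on any set of points
    where [dt alpha <= eps], the integral of [h1] is at most [2 eps / c0] times
    the energy ([local_energy_bound]), which is bounded in time.

    It remains to see that [dt alpha] is small on the window. By sublinearity of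
    [omega] ([omega_sublinear]), the window around the line [x = v t] lies,
    for large [t], in a cone [|x| <= (1 - d) t] with [d > 0]. There both null
    coordinates [t + x] and [t - x] are at least [d t], so that the Schwartz
    profiles, evaluated at these coordinates, are [O(1/t)]
    ([dt_alpha_interior_decay]). *)

Local Open Scope classical_set_scope.
Local Open Scope ring_scope.

(** * The energy density in the null frame *)

Section EnergyDensity.
Context {R : realType}.
Implicit Types (Lambda phi alpha : R -> R -> R) (t x : R).

Definition energy_density Lambda phi alpha t x : R :=
  - (kappa alpha t x * (dt alpha t x * h1 Lambda phi t x
                        - 2 * dx alpha t x * h2 Lambda phi t x)).

(** The gaps in the two inequalities are the squared lengths of the derivatives
    of [(Lambda, phi)] along the null directions, for the metric
    [dLambda^2 + 4 sinh(Lambda)^2 dphi^2]. *)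
Lemma h2_null_bounds Lambda phi t x :
  - h1 Lambda phi t x <= 2 * h2 Lambda phi t x <= h1 Lambda phi t x.
Proof.
rewrite /h1 /h2; set s := sinh _.
set p := dt Lambda t x; set q := dx Lambda t x.
set m := dt phi t x; set n := dx phi t x.
have hp := sqr_ge0 (p + q); have hm := sqr_ge0 (p - q).
have sp := sqr_ge0 (2 * s * (m + n)); have sm := sqr_ge0 (2 * s * (m - n)).
apply/andP; split; rewrite -subr_ge0.
  have -> : 2 * (p * q + 4 * s ^+ 2 * m * n)
      - - (p ^+ 2 + q ^+ 2 + 4 * s ^+ 2 * (n ^+ 2 + m ^+ 2))
      = (p + q) ^+ 2 + (2 * s * (m + n)) ^+ 2 by ring.
  exact: addr_ge0.
have -> : p ^+ 2 + q ^+ 2 + 4 * s ^+ 2 * (n ^+ 2 + m ^+ 2)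
      - 2 * (p * q + 4 * s ^+ 2 * m * n)
    = (p - q) ^+ 2 + (2 * s * (m - n)) ^+ 2 by ring.
  exact: addr_ge0.
Qed.

Lemma h1_ge0 Lambda phi t x : 0 <= h1 Lambda phi t x.
Proof. by have /andP[] := h2_null_bounds Lambda phi t x; lra. Qed.

(** Writing the difference of the two sides in the null frame gives a sum of
    squares weighted by the nonnegative numbers [h + 2 g] and [h - 2 g]. *)
Lemma null_frame_bound (A a b h g : R) :
  0 < A -> b ^+ 2 < a ^+ 2 -> - h <= 2 * g <= h ->
  A * h <= 2 * a * (- (A / (b ^+ 2 - a ^+ 2) * (a * h - 2 * b * g))).
Proof.
move=> A0 ab /andP[gl gu].
have d0 : 0 < a ^+ 2 - b ^+ 2 by rewrite subr_gt0.
have -> : 2 * a * (- (A / (b ^+ 2 - a ^+ 2) * (a * h - 2 * b * g)))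
    = A * (2 * a * (a * h - 2 * b * g)) / (a ^+ 2 - b ^+ 2).
  by field; rewrite subr_eq0 (gt_eqF ab) subr_eq0 (lt_eqF ab).
rewrite ler_pdivlMr// -[leLHS]mulrA ler_pM2l//.
have hp : 0 <= (a - b) ^+ 2 * (h + 2 * g) by rewrite mulr_ge0 ?sqr_ge0//; lra.
have hm : 0 <= (a + b) ^+ 2 * (h - 2 * g) by rewrite mulr_ge0 ?sqr_ge0//; lra.
rewrite -subr_ge0.
have -> : 2 * a * (a * h - 2 * b * g) - h * (a ^+ 2 - b ^+ 2)
    = ((a - b) ^+ 2 * (h + 2 * g) + (a + b) ^+ 2 * (h - 2 * g)) / 2.
  by field.
by rewrite divr_ge0 ?addr_ge0.
Qed.

Lemma energy_density_lower_bound Lambda phi alpha t x :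
  0 < alpha t x -> (dx alpha t x) ^+ 2 - (dt alpha t x) ^+ 2 < 0 ->
  alpha t x * h1 Lambda phi t x
    <= 2 * dt alpha t x * energy_density Lambda phi alpha t x.
Proof.
move=> a0; rewrite subr_lt0 => ab.
exact: null_frame_bound (h2_null_bounds _ _ _ _).
Qed.

Lemma energy_density_ge0 Lambda phi alpha t x :
  0 < alpha t x -> 0 < dt alpha t x ->
  (dx alpha t x) ^+ 2 - (dt alpha t x) ^+ 2 < 0 ->
  0 <= energy_density Lambda phi alpha t x.
Proof.
move=> A0 a0 ab; have := energy_density_lower_bound Lambda phi A0 ab.
have := mulr_ge0 (ltW A0) (h1_ge0 Lambda phi t x) => /le_trans/[apply].
by rewrite pmulr_rge0// mulr_gt0.
Qed.

Lemma energyE Lambda phi alpha t :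
  (forall x, 0 <= energy_density Lambda phi alpha t x) ->
  energy Lambda phi alpha t =
  (\int[@lebesgue_measure R]_x (energy_density Lambda phi alpha t x)%:E)%E.
Proof.
move=> e0; rewrite /energy.
under eq_integral do rewrite -[X in X%:E]opprK EFinN.
by rewrite integral_ge0N ?oppeK// => x _; rewrite lee_fin; exact: e0.
Qed.

End EnergyDensity.

(** * Measurability on time slices *)

Section Slices.
Context {R : realType}.
Implicit Types (u Lambda phi alpha : R -> R -> R) (t x : R).

(** The whole line [{t} x R] lies in the closed half-plane, so one-sided
    regularity at [t = 0] is enough for ordinary continuity in [x]. *)
Lemma Ck_slice_continuous k u t : Ck k u -> 0 <= t -> continuous (u t).
Proof.
move=> uk t0; have {uk} : {within halfplane,
    continuous (fun p : R * R => u p.1 p.2)} by case: k uk => [|k] [].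
move=> /subspace_continuousP cu x U /(cu (t, x) t0)[[A B] [/= At Bx] sub].
apply: filterS Bx => y By; apply: (sub (t, y)) => //.
by split => //; exact: nbhs_singleton.
Qed.

Lemma Ck_slice_measurable k u t : Ck k u -> 0 <= t ->
  measurable_fun setT (u t).
Proof.
by move=> uk t0; apply: continuous_measurable_fun; exact: Ck_slice_continuous uk t0.
Qed.

Lemma smooth_dt_slice_measurable u t : smooth u -> 0 <= t ->
  measurable_fun setT (dt u t).
Proof. by move=> /(_ 1%N)[_ [_ du _]]; exact: (@Ck_slice_measurable 0%N). Qed.

Lemma smooth_dx_slice_measurable u t : smooth u -> 0 <= t ->
  measurable_fun setT (dx u t).
Proof. by move=> /(_ 1%N)[_ [_ _ du]]; exact: (@Ck_slice_measurable 0%N). Qed.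

Lemma measurable_sinh (f : R -> R) : measurable_fun setT f ->
  measurable_fun setT (fun x => sinh (f x)).
Proof.
move=> mf; apply: measurable_funM => //; apply: measurable_funB.
  exact: measurableT_comp.
by apply: measurableT_comp => //; exact: measurable_funN.
Qed.

Lemma measurable_h1 Lambda phi t : smooth Lambda -> smooth phi -> 0 <= t ->
  measurable_fun setT (h1 Lambda phi t).
Proof.
move=> sL sp t0; have ms := measurable_sinh (Ck_slice_measurable (sL 0%N) t0).
have mLt := smooth_dt_slice_measurable sL t0.
have mLx := smooth_dx_slice_measurable sL t0.
have mpt := smooth_dt_slice_measurable sp t0.
have mpx := smooth_dx_slice_measurable sp t0.
apply: measurable_funD; first by apply: measurable_funD; exact: measurable_funX.
apply: measurable_funM; last by apply: measurable_funD; exact: measurable_funX.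
by apply: measurable_funM; [exact: measurable_cst | exact: measurable_funX].
Qed.

Lemma measurable_h2 Lambda phi t : smooth Lambda -> smooth phi -> 0 <= t ->
  measurable_fun setT (h2 Lambda phi t).
Proof.
move=> sL sp t0; have ms := measurable_sinh (Ck_slice_measurable (sL 0%N) t0).
have mLt := smooth_dt_slice_measurable sL t0.
have mLx := smooth_dx_slice_measurable sL t0.
have mpt := smooth_dt_slice_measurable sp t0.
have mpx := smooth_dx_slice_measurable sp t0.
apply: measurable_funD; first exact: measurable_funM.
apply: measurable_funM; last exact: mpx.
apply: measurable_funM; last exact: mpt.
by apply: measurable_funM; [exact: measurable_cst | exact: measurable_funX].
Qed.

Lemma measurable_field_density Lambda phi t :
  smooth Lambda -> smooth phi -> 0 <= t ->
  measurable_fun setT (fun x => (dt Lambda t x) ^+ 2 + (dx Lambda t x) ^+ 2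
    + (sinh (Lambda t x)) ^+ 2 * ((dt phi t x) ^+ 2 + (dx phi t x) ^+ 2)).
Proof.
move=> sL sp t0; have ms := measurable_sinh (Ck_slice_measurable (sL 0%N) t0).
have mLt := smooth_dt_slice_measurable sL t0.
have mLx := smooth_dx_slice_measurable sL t0.
have mpt := smooth_dt_slice_measurable sp t0.
have mpx := smooth_dx_slice_measurable sp t0.
apply: measurable_funD; first by apply: measurable_funD; exact: measurable_funX.
apply: measurable_funM; first exact: measurable_funX.
by apply: measurable_funD; exact: measurable_funX.
Qed.

(** The denominator of [kappa] does not vanish on a time slice, so [kappa] is
    even continuous there. *)
Lemma measurable_kappa alpha t : smooth alpha -> 0 <= t ->
  (forall x, (dx alpha t x) ^+ 2 - (dt alpha t x) ^+ 2 < 0) ->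
  measurable_fun setT (kappa alpha t).
Proof.
move=> sa t0 ab; apply: continuous_measurable_fun => x.
have [_ [_ cdt cdx]] := sa 1%N.
apply: cvgM; first exact: Ck_slice_continuous (sa 0%N) t0 x.
apply: cvgV; first by rewrite lt_eqF.
apply: cvgB; rewrite !expr2; apply: cvgM.
- exact: (@Ck_slice_continuous 0%N) cdx t0 x.
- exact: (@Ck_slice_continuous 0%N) cdx t0 x.
- exact: (@Ck_slice_continuous 0%N) cdt t0 x.
- exact: (@Ck_slice_continuous 0%N) cdt t0 x.
Qed.

Lemma measurable_energy_density Lambda phi alpha t :
  smooth Lambda -> smooth phi -> smooth alpha -> 0 <= t ->
  (forall x, (dx alpha t x) ^+ 2 - (dt alpha t x) ^+ 2 < 0) ->
  measurable_fun setT (energy_density Lambda phi alpha t).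
Proof.
move=> sL sp sa t0 ab; apply: measurable_funN.
apply: measurable_funM; first exact: measurable_kappa.
have mdt := smooth_dt_slice_measurable sa t0.
have mdx := smooth_dx_slice_measurable sa t0.
have mh1 := measurable_h1 sL sp t0; have mh2 := measurable_h2 sL sp t0.
by apply: measurable_funB; repeat apply: measurable_funM.
Qed.

End Slices.

(** * Localized energy bound *)

Section LocalEnergy.
Context {R : realType}.
Context (Lambda phi alpha : R -> R -> R) (t c : R)
  (Lambda_smooth : smooth Lambda) (phi_smooth : smooth phi)
  (alpha_smooth : smooth alpha) (t_ge0 : 0 <= t) (c_gt0 : 0 < c)
  (alpha_ge : forall x, c <= alpha t x)
  (dt_alpha_gt0 : forall x, 0 < dt alpha t x)
  (alpha_timelike : forall x,
     (dx alpha t x) ^+ 2 - (dt alpha t x) ^+ 2 < 0).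

Local Notation density := (energy_density Lambda phi alpha t).

Let density_ge0 x : 0 <= density x.
Proof.
by apply: energy_density_ge0 => //; apply: lt_le_trans (alpha_ge x).
Qed.

Lemma energy_ge0 : (0 <= energy Lambda phi alpha t)%E.
Proof.
by rewrite energyE//; apply: integral_ge0 => x _; rewrite lee_fin.
Qed.

(** The inverse weight of the energy turns a bound on [dt alpha] into a gain of
    the same size. *)
Lemma local_energy_bound (D : set R) (eps : R) : measurable D ->
  0 <= eps -> (forall x, D x -> dt alpha t x <= eps) ->
  (\int[@lebesgue_measure R]_(x in D) (h1 Lambda phi t x)%:E
    <= (2 * eps / c)%:E * energy Lambda phi alpha t)%E.
Proof.
move=> mD eps0 Deps.
have k0 : 0 <= 2 * eps / c by rewrite divr_ge0 ?mulr_ge0// ltW.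
have me := measurable_energy_density Lambda_smooth phi_smooth alpha_smooth
  t_ge0 alpha_timelike.
have mh := measurable_h1 Lambda_smooth phi_smooth t_ge0.
have me' : measurable_fun setT (fun x => (density x)%:E).
  exact/measurable_EFinP.
have meD : measurable_fun D (fun x => (density x)%:E).
  exact: measurable_funS me'.
rewrite energyE//.
apply: (@le_trans _ _
  (\int[@lebesgue_measure R]_(x in D) ((2 * eps / c)%:E * (density x)%:E))%E).
  apply: ge0_le_integral => //.
  - by move=> x _; rewrite lee_fin h1_ge0.
  - by apply/measurable_EFinP; exact: measurable_funS mh.
  - exact: measurable_funeM.
  - move=> x Dx; rewrite -EFinM lee_fin mulrAC ler_pdivlMr// mulrC.
    apply: (@le_trans _ _ (alpha t x * h1 Lambda phi t x)).
      by rewrite ler_wpM2r ?h1_ge0.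
    apply: le_trans (energy_density_lower_bound _ _ _ (alpha_timelike x)) _.
      exact: lt_le_trans (alpha_ge x).
    by rewrite ler_wpM2r// ler_pM2l// Deps.
rewrite ge0_integralZl_EFin//; last by move=> x _; rewrite lee_fin.
apply: lee_wpmul2l; first by rewrite lee_fin.
by apply: ge0_subset_integral => // x _; rewrite lee_fin.
Qed.

End LocalEnergy.

(** * The window stays away from the light cone *)

Section Window.
Context {R : realType}.

Lemma omega_sublinear (C d : R) : 0 < C -> 0 < d ->
  \forall t \near +oo, C * omega t <= d * t.
Proof.
move=> C0 d0; near=> t.
have K0 : 0 < C / d by rewrite divr_gt0.
have t0 : 0 < t by near: t; exact: nbhs_pinfty_gt.
(* The summand [1] gives [ln t <= (ln t)^2]; then [C / d <= ln t] suffices. *)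
have lnt : 1 + C / d < ln t.
  by rewrite -[ltLHS]expRK ltr_ln ?posrE ?expR_gt0//.
have l0 : 0 < ln t by apply: lt_trans lnt; rewrite addr_gt0.
rewrite /omega mulrCA [leRHS]mulrC ler_pM2l// ler_pdivrMr ?exprn_gt0//.
rewrite mulrC -ler_pdivrMr//; apply: ltW; apply: (@lt_trans _ _ (ln t)); first lra.
by rewrite expr2 ltr_pMr//; lra.
Unshelve. all: by end_near. Qed.

(** In a cone strictly inside the light cone, both null coordinates are
    bounded below by a multiple of [t]; one moment of each profile suffices. *)
Lemma dt_alpha_interior_decay (F H : R -> R) (d : R) :
  schwartz F -> schwartz H -> 0 < d ->
  exists2 K, 0 <= K & forall t x, 0 < t -> `|x| <= (1 - d) * t ->
    F (t + x) + H (t - x) <= K / t.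
Proof.
move=> [_ sF] [_ sH] d0.
have decay (G : R -> R) : (forall m n, exists M : R,
    forall y, `|y| ^+ m * `|derive1n n G y| <= M) ->
    exists2 M, 0 <= M & forall t y, 0 < t -> d * t <= y -> G y <= M / d / t.
  move=> /(_ 1%N 0%N)[M]; rewrite /= => GM.
  exists M; first by apply: le_trans (GM 0); rewrite mulr_ge0.
  move=> t y t0 ty; have dt0 : 0 < d * t by rewrite mulr_gt0.
  have y0 : 0 < y by exact: lt_le_trans ty.
  apply: le_trans (ler_norm _) _.
  rewrite -mulrA -invfM ler_pdivlMr// mulrC.
  by apply: le_trans (GM y); rewrite expr1 (gtr0_norm y0) ler_wpM2r.
have [M M0 FM] := decay F sF; have [N N0 HN] := decay H sH.
exists (M / d + N / d); first by apply: addr_ge0; rewrite divr_ge0// ltW.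
move=> t x t0; rewrite ler_norml => /andP[xl xu].
by rewrite mulrDl lerD ?FM ?HN//; lra.
Qed.

End Window.

Theorem theorem2p3 (R : realType) (Lambda phi alpha : R -> R -> R)
  (Lambda_smooth : smooth Lambda) (phi_smooth : smooth phi)
  (alpha_smooth : smooth alpha)
  (sol : solution Lambda phi alpha)
  (alpha_gt0 : forall t x : R, 0 <= t -> 0 < alpha t x)
  (dt_alpha_gt0 : forall t x : R, 0 <= t -> 0 < dt alpha t x)
  (alpha_timelike : forall t x : R, 0 <= t ->
     (dx alpha t x) ^+ 2 - (dt alpha t x) ^+ 2 < 0)
  (energy_bounded :
     (ereal_sup [set energy Lambda phi alpha t | t in [set t : R | (0 <= t)%R]]
      < +oo)%E)
  (alpha_lower : exists2 c0 : R, 0 < c0 &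
     forall t x : R, 0 <= t -> c0 < alpha t x)
  (dt_alpha_schwartz : exists F H : R -> R,
     [/\ schwartz F, schwartz H &
         forall t x : R, 0 <= t -> dt alpha t x = F (t + x) + H (t - x)])
  (v : R) (v_lt1 : `|v| < 1) (C : R) (C_gt0 : 0 < C) :
  (\int[@lebesgue_measure R]_(x in [set x : R | (`|x - v * t| <= C * omega t)%R])
     ((dt Lambda t x) ^+ 2 + (dx Lambda t x) ^+ 2
      + (sinh (Lambda t x)) ^+ 2 * ((dt phi t x) ^+ 2 + (dx phi t x) ^+ 2))%:E)%E
    @[t --> +oo] --> (0 : \bar R)%E.
Proof.
have [c c0 alpha_ge] := alpha_lower.
have [F [H [sF sH dtE]]] := dt_alpha_schwartz.
have energy_nonneg t : 0 <= t -> (0 <= energy Lambda phi alpha t)%E.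
  move=> t0; apply: (@energy_ge0 _ _ _ _ _ c) => // x; last 2 first.
  - exact: dt_alpha_gt0.
  - exact: alpha_timelike.
  by rewrite ltW// alpha_ge.
have [E0 energy_le] : exists E0 : R,
    forall t, 0 <= t -> (energy Lambda phi alpha t <= E0%:E)%E.
  set S := ereal_sup _ in energy_bounded.
  have le_S t : 0 <= t -> (energy Lambda phi alpha t <= S)%E.
    by move=> t0; apply: ereal_sup_ubound; exists t.
  have S0 : (0 <= S)%E by apply: le_trans (le_S 0 _); rewrite ?energy_nonneg.
  have SE : S \is a fin_num by rewrite ge0_fin_numE.
  exists (fine S).
  by move=> t t0; rewrite fineK// le_S.
(* Half of the gap [1 - |v|] absorbs the width of the window; the other half
   keeps it inside the light cone. *)
pose d := (1 - `|v|) / 2.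
have d0 : 0 < d by rewrite divr_gt0// subr_gt0.
have [K K0 interior_decay] := dt_alpha_interior_decay sF sH d0.
apply: (@squeeze_cvge _ _ _ _ (fun=> 0%E) _
  (fun t => (2 * K / c * E0 / t)%:E)); last 2 first.
- exact: cvg_cst.
- have -> : 0%E = (2 * K / c * E0 * 0)%:E :> \bar R by rewrite mulr0.
  apply: cvg_EFin; first exact: nearW.
  apply: cvgM; first exact: cvg_cst.
  by apply/gtr0_cvgV0 => //; exact: nbhs_pinfty_gt.
near=> t.
have t0 : 0 < t by near: t; exact: nbhs_pinfty_gt.
have t0' := ltW t0.
have window : C * omega t <= d * t by near: t; exact: omega_sublinear.
set W := [set x | _].
have mW : measurable W.
  have -> : W = `[v * t - C * omega t, v * t + C * omega t]%classic.
    by apply/seteqP; split=> x; rewrite /W /= in_itv/= ler_distl.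
  exact: measurable_itv.
have in_cone x : W x -> `|x| <= (1 - d) * t.
  move=> Wx; rewrite -(subrK (v * t) x).
  apply: le_trans (ler_normD _ _) _; rewrite normrM (gtr0_norm t0).
  apply: (@le_trans _ _ (d * t + `|v| * t)).
    by rewrite lerD2r; exact: le_trans Wx window.
  by rewrite -mulrDl ler_pM2r// /d; lra.
have density_ge0 x : 0 <= (dt Lambda t x) ^+ 2 + (dx Lambda t x) ^+ 2
    + (sinh (Lambda t x)) ^+ 2 * ((dt phi t x) ^+ 2 + (dx phi t x) ^+ 2).
  apply: addr_ge0; last apply: mulr_ge0; rewrite ?sqr_ge0//;
    by apply: addr_ge0; exact: sqr_ge0.
apply/andP; split.
  by apply: integral_ge0 => x _; rewrite lee_fin.
apply: (@le_trans _ _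
    (\int[@lebesgue_measure R]_(x in W) (h1 Lambda phi t x)%:E)%E).
  apply: ge0_le_integral => //.
  - by move=> x _; rewrite lee_fin.
  - apply/measurable_EFinP/measurable_funTS.
    exact: measurable_field_density.
  - by apply/measurable_EFinP/measurable_funTS; exact: measurable_h1.
  - move=> x _; rewrite lee_fin /h1 lerD2l [X in _ <= _ * X]addrC.
    rewrite ler_wpM2r ?addr_ge0 ?sqr_ge0// ler_peMl ?sqr_ge0//.
    by rewrite ler1n.
apply: (@le_trans _ _ ((2 * (K / t) / c)%:E * energy Lambda phi alpha t)%E).
  apply: local_energy_bound => // [x|x|x| |x Wx].
  - by rewrite ltW// alpha_ge.
  - exact: dt_alpha_gt0.
  - exact: alpha_timelike.
  - by rewrite divr_ge0.
  - by rewrite dtE//; apply: interior_decay => //; exact: in_cone.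
have -> : 2 * K / c * E0 / t = 2 * (K / t) / c * E0.
  by field; rewrite !gt_eqF.
rewrite [leRHS]EFinM; apply: lee_wpmul2l; last exact: energy_le.
by rewrite lee_fin !(divr_ge0, mulr_ge0)// ltW.
Unshelve. all: by end_near. Qed.
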